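(* Let $\mathbf{H}$ be a quantum conditional entropy (normalized so that $\mathbf{H}(A|B)_{\mathbf{u}^{(2)}\otimes\rho}=1$). Then for all finite-dimensional systems $A,B$ and every state $\rho_{AB}\in\mathfrak{D}(AB)$, $$\mathbf{H}(A|B)_\rho\ \ge\ H_{\min}(A|B)_\rho .$$ Equality is attained if $\rho_{AB}$ is equal to a maximally entangled state $\Phi^{(k)}_{A'B'}$ up to the action of local isometric channels. Thus, for every such conditional entropy $\mathbf{H}$ and every integer $k\ge 1$, $$\mathbf{H}(A|B)_{\Phi^{(k)}}=-\log_2 k .$$
   Context: All systems (Hilbert spaces) are finite-dimensional; $|A|$ is the dimension of $A$, $\mathfrak{D}(A)$ the set of density operators on $A$, $I_A$ the identity, $\mathbf{u}_A=I_A/|A|$ the uniform state, and $\mathbf{u}^{(d)}$ the uniform state in dimension $d$. $\rho_B=\operatorname{Tr}_A[\rho_{AB}]$. A quantum channel is a completely positive trace-preserving linear map; an isometric channel is one of the form $(\cdot)\mapsto U(\cdot)U^\dagger$ with $U^\dagger U=I$. Maps act as the identity on systems not mentioned. Conditionally unital channel: $\mathcal{N}_{AB\to AB'}$ such that for every $\rho_B\in\mathfrak{D}(B)$ there is $\sigma_{B'}\in\mathfrak{D}(B')$ with $\mathcal{N}(\mathbf{u}_A\otimes\rho_B)=\mathbf{u}_A\otimes\sigma_{B'}$. $A\not\to B'$ semi-causal channel: $\mathcal{N}_{AB\to AB'}$ such that $\operatorname{Tr}_A\circ\mathcal{N}\circ\mathcal{M}_A=\operatorname{Tr}_A\circ\mathcal{N}$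 for every channel $\mathcal{M}_A$ from $A$ to $A$. Conditionally mixing channel: a channel $\mathcal{N}_{AB\to AB'}$ that is both conditionally unital and $A\not\to B'$ semi-causal. Conditional majorization: $\rho_{AB}\succ_A\sigma_{A'B'}$ if there exist a system $A''$ with $|A''|\ge\max\{|A|,|A'|\}$, isometric channels $\mathcal{V}_{A\to A''}$, $\mathcal{U}_{A'\to A''}$, and a conditionally mixing channel $\mathcal{N}_{A''B\to A''B'}$ with $\mathcal{U}_{A'\to A''}(\sigma_{A'B'})=(\mathcal{N}_{A''B\to A''B'}\circ\mathcal{V}_{A\to A''})(\rho_{AB})$. Quantum conditional entropy: a function $\mathbf{H}:\bigcup_{A,B}\mathfrak{D}(AB)\to\mathbb{R}$ (value at $\rho_{AB}$ written $\mathbf{H}(A|B)_\rho$; one-dimensional systems allowed) that is not the zero function when $|B|=1$ and satisfies, for all systems and states: (1) monotonicity: $\rho_{AB}\succ_A\sigma_{A'B'}\Rightarrow\mathbf{H}(A|B)_\rho\le\mathbf{H}(A'|B')_\sigma$; (2) additivity: $\mathbf{H}(AA'|BB')_{\rho\otimes\sigma}=\mathbf{H}(A|B)_\rho+\mathbf{H}(A'|B')_\sigma$. Normalization convention: $\mathbf{H}(A|B)_{\mathbf{u}^{(2)}\otimes\rho}=1$ for every state $\mathbf{u}^{(2)}_A\otimes\rho_B$ with $|A|=2$. Conditional min-entropy: $H_{\min}(A|B)_\rho=-\log_2\inf\{\lambda\ge0:\rho_{AB}\le\lambda\, I_A\otimes\rho_B\}$, where $\leq$ is the Loewner order. Maximally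 entangled state: $\Phi^{(k)}=|\Phi^{(k)}\rangle\langle\Phi^{(k)}|$ with $|\Phi^{(k)}\rangle=\frac{1}{\sqrt k}\sum_{i=1}^k|i\rangle\otimes|i\rangle$ on two $k$-dimensional systems. *)

(* Defs.v *)
From mathcomp Require Import all_boot all_order all_algebra.
From mathcomp Require Import complex mxtens.
From mathcomp Require Import classical_sets reals exp.

Set Implicit Arguments.
Unset Strict Implicit.
Unset Printing Implicit Defensive.

Import Order.TTheory GRing.Theory Num.Theory.
Local Open Scope ring_scope.
Local Open Scope sesquilinear_scope.

(* A system of dimension n is C^n and its operators are 'M[C]_n.  A bipartite
   system AB with |A| = a, |B| = b has operators 'M[C]_(a * b), where the index
   mxtens_index (i, j) stands for the basis vector |i>_A (x) |j>_B; this is the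
   convention of the Kronecker product *t. *)

Section Operators.
Variable C : numClosedFieldType.

(* In a numClosedFieldType, 0 <= z says that z is real and nonnegative; hence
   this condition forces M to be Hermitian. *)
Definition psd n (M : 'M[C]_n) : Prop :=
  forall v : 'cV[C]_n, 0 <= (v^t* *m M *m v) 0 0.

Definition loewner_le n (X Y : 'M[C]_n) : Prop := psd (Y - X).

Definition density n (rho : 'M[C]_n) : Prop := psd rho /\ \tr rho = 1.

Definition uniform n : 'M[C]_n := (n%:R^-1)%:M.

(* The operator (<i|_B) X (|j>_B) on A. *)
Definition blockB a b (X : 'M[C]_(a * b)) (i j : 'I_b) : 'M[C]_a :=
  \matrix_(p, q) X (mxtens_index (p, i)) (mxtens_index (q, j)).

(* The partial trace Tr_A. *)
Definition ptrA a b (X : 'M[C]_(a * b)) : 'M[C]_b :=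
  \matrix_(i, j) \tr (blockB X i j).

(* The map N (x) id_B. *)
Definition actA a a' b (N : 'M[C]_a -> 'M[C]_a') (X : 'M[C]_(a * b)) :
    'M[C]_(a' * b) :=
  \sum_(i < b) \sum_(j < b) N (blockB X i j) *t delta_mx i j.

Definition completely_positive n m (N : 'M[C]_n -> 'M[C]_m) : Prop :=
  forall (k : nat) (X : 'M[C]_(n * k)), psd X -> psd (actA N X).

Definition trace_preserving n m (N : 'M[C]_n -> 'M[C]_m) : Prop :=
  forall X : 'M[C]_n, \tr (N X) = \tr X.

Definition channel n m (N : {linear 'M[C]_n -> 'M[C]_m}) : Prop :=
  completely_positive N /\ trace_preserving N.

Definition isometry n m (U : 'M[C]_(m, n)) : Prop := U^t* *m U = 1%:M.

Definition isochan n m (U : 'M[C]_(m, n)) (X : 'M[C]_n) : 'M[C]_m :=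
  U *m X *m U^t*.

Definition conditionally_unital a b b'
    (N : {linear 'M[C]_(a * b) -> 'M[C]_(a * b')}) : Prop :=
  forall rho : 'M[C]_b, density rho ->
    exists2 sigma : 'M[C]_b', density sigma &
      N (uniform a *t rho) = uniform a *t sigma.

Definition semicausal a b b'
    (N : {linear 'M[C]_(a * b) -> 'M[C]_(a * b')}) : Prop :=
  forall M : {linear 'M[C]_a -> 'M[C]_a}, channel M ->
    forall X : 'M[C]_(a * b), ptrA (N (actA M X)) = ptrA (N X).

Definition conditionally_mixing a b b'
    (N : {linear 'M[C]_(a * b) -> 'M[C]_(a * b')}) : Prop :=
  [/\ channel N, conditionally_unital N & semicausal N].

Definition cond_majorizes a b a' b'
    (rho : 'M[C]_(a * b)) (sigma : 'M[C]_(a' * b')) : Prop :=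
  exists (a2 : nat) (V : 'M[C]_(a2, a)) (U : 'M[C]_(a2, a'))
         (N : {linear 'M[C]_(a2 * b) -> 'M[C]_(a2 * b')}),
    [/\ (maxn a a' <= a2)%N, isometry V, isometry U, conditionally_mixing N &
        actA (isochan U) sigma = N (actA (isochan V) rho)].

(* The reordering of tensor factors A B A' B' -> A A' B B'. *)
Definition reorder a b a' b' (X : 'M[C]_((a * b) * (a' * b'))) :
    'M[C]_((a * a') * (b * b')) :=
  let f (k : 'I_((a * a') * (b * b'))) :=
    let p := mxtens_unindex (mxtens_unindex k).1 in
    let q := mxtens_unindex (mxtens_unindex k).2 in
    mxtens_index (mxtens_index (p.1, q.1), mxtens_index (p.2, q.2)) in
  \matrix_(k, l) X (f k) (f l).

Definition ket_Phi k : 'cV[C]_(k * k) :=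
  (sqrtC k%:R)^-1 *:
  \sum_(i < k) ((delta_mx i 0 : 'cV[C]_k) *t (delta_mx i 0 : 'cV[C]_k)).

Definition Phi k : 'M[C]_(k * k) := ket_Phi k *m (ket_Phi k)^t*.

(* Equality up to the action of local isometric channels: both states may be
   embedded, as in cond_majorizes. *)
Definition local_iso_equiv a b a' b'
    (rho : 'M[C]_(a * b)) (sigma : 'M[C]_(a' * b')) : Prop :=
  exists (a2 b2 : nat) (V : 'M[C]_(a2, a)) (W : 'M[C]_(b2, b))
         (V' : 'M[C]_(a2, a')) (W' : 'M[C]_(b2, b')),
    [/\ isometry V, isometry W, isometry V', isometry W' &
        isochan (V *t W) rho = isochan (V' *t W') sigma].

End Operators.

Section Entropies.
Variable R : realType.
Local Notation C := R[i].

Definition log2 (x : R) : R := ln x / ln 2.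

Definition Hmin a b (rho : 'M[C]_(a * b)) : R :=
  - log2 (inf [set l : R | 0 <= l /\
      loewner_le rho ((l%:C)%C *: (1%:M *t ptrA rho))]%classic).

(* H is a total function on operators of which only the values on density
   operators matter: all conditions below are restricted to them. *)
Record conditional_entropy (H : forall a b : nat, 'M[C]_(a * b) -> R) : Prop :=
  ConditionalEntropy {
    ce_nonzero : exists (a : nat) (rho : 'M[C]_(a * 1)),
      density rho /\ H a 1%N rho <> 0;
    ce_monotone : forall (a b a' b' : nat)
        (rho : 'M[C]_(a * b)) (sigma : 'M[C]_(a' * b')),
      density rho -> density sigma -> cond_majorizes rho sigma ->
      H a b rho <= H a' b' sigma;
    ce_additive : forall (a b a' b' : nat)
        (rho : 'M[C]_(a * b)) (sigma : 'M[C]_(a' * b')),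
      density rho -> density sigma ->
      H (a * a')%N (b * b')%N (reorder (rho *t sigma)) =
      H a b rho + H a' b' sigma
  }.

Definition normalized_entropy
    (H : forall a b : nat, 'M[C]_(a * b) -> R) : Prop :=
  forall (b : nat) (rho : 'M[C]_b), density rho ->
    H 2%N b (uniform C 2 *t rho) = 1.

End Entropies.

(* Main.v *)
(** The state uniform on m dimensions conditionally majorizes rho (x) u_n as soon
    as m rho <= n (I (x) rho_B): test the projector P_m, prepare rho (x) u_n on
    success, and on failure prepare the state that completes the average to
    u (x) rho_B.  Monotonicity and additivity give log m <= H(rho) + log n, and
    letting m / n tend to the reciprocal of the infimum gives Hmin <= H.

    Conversely, an operator 0 <= M <= 1 with Tr_A M = I / k and Tr(M rho) = 1
    turns rho (x) u_k into a pure state, because M (x) I has probability 1 / |AA'|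
    on every u (x) sigma; hence H(rho) + log k <= 0.  For Phi^(k) such an M is
    Phi^(k) itself, while rho <= k (I (x) rho_B) gives Hmin >= - log k, so that
    Hmin <= H forces equality. *)
From HB Require Import structures.
From mathcomp Require Import all_boot all_order all_algebra.
From mathcomp Require Import complex reals sequences.
From mathcomp Require Import mxtens classical_sets exp.
From mathcomp Require Import ring lra.
Require Import Defs.
Import Order.TTheory GRing.Theory Num.Theory.
Local Open Scope ring_scope.
Local Open Scope sesquilinear_scope.

Set Implicit Arguments.
Unset Strict Implicit.
Unset Printing Implicit Defensive.

(** * Positive semidefinite matrices *)

Section Positivity.
Variable C : numClosedFieldType.

Lemma adjmxM m n p (A : 'M[C]_(m, n)) (B : 'M[C]_(n, p)) :
  (A *m B)^t* = B^t* *m A^t*.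
Proof. by rewrite trmx_mul map_mxM. Qed.

Lemma adjmx_tens m n p q (A : 'M[C]_(m, n)) (B : 'M[C]_(p, q)) :
  (A *t B)^t* = A^t* *t B^t*.
Proof. by rewrite trmx_tens map_mxT. Qed.

Lemma adjmx1 n : (1%:M : 'M[C]_n)^t* = 1%:M.
Proof. by rewrite trmx1 map_mx1. Qed.

Lemma adjmxD m n (A B : 'M[C]_(m, n)) : (A + B)^t* = A^t* + B^t*.
Proof. by rewrite linearD map_mxD. Qed.

Lemma adjmxN m n (A : 'M[C]_(m, n)) : (- A)^t* = - A^t*.
Proof. by rewrite linearN map_mxN. Qed.

Lemma adjmx_sum m n (I : Type) (r : seq I) (F : I -> 'M[C]_(m, n)) :
  (\sum_(i <- r) F i)^t* = \sum_(i <- r) (F i)^t*.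
Proof.
apply: (big_morph (fun A : 'M[C]_(m, n) => A^t*) (@adjmxD m n)).
by rewrite trmx0 map_mx0.
Qed.

Lemma adjmxZ m n (c : C) (A : 'M[C]_(m, n)) : (c *: A)^t* = c^* *: A^t*.
Proof. by rewrite linearZ map_mxZ. Qed.

Lemma adjmx_delta m n i j : (delta_mx i j : 'M[C]_(m, n))^t* = delta_mx j i.
Proof. by rewrite trmx_delta map_delta_mx. Qed.

Lemma psd0 n : psd (0 : 'M[C]_n).
Proof. by move=> v; rewrite mulmx0 mul0mx mxE. Qed.

Lemma psdD n (A B : 'M[C]_n) : psd A -> psd B -> psd (A + B).
Proof.
by move=> pA pB v; rewrite mulmxDr mulmxDl mxE addr_ge0 ?pA ?pB.
Qed.

Lemma psd_sum n (I : finType) (F : I -> 'M[C]_n) :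
  (forall i, psd (F i)) -> psd (\sum_i F i).
Proof.
move=> pF; elim/big_ind: _ => //; [exact: psd0|exact: psdD].
Qed.

Lemma psdZ n (c : C) (A : 'M[C]_n) : 0 <= c -> psd A -> psd (c *: A).
Proof.
by move=> c0 pA v; rewrite -scalemxAr -scalemxAl mxE mulr_ge0 ?pA.
Qed.

Lemma psd_conj m n (K : 'M[C]_(m, n)) (A : 'M[C]_n) :
  psd A -> psd (K *m A *m K^t*).
Proof.
move=> pA v; have := pA (K^t* *m v).
by rewrite adjmxM trmxCK !mulmxA.
Qed.

Lemma psd_gram m n (L : 'M[C]_(m, n)) : psd (L^t* *m L).
Proof.
move=> v; rewrite mulmxA -adjmxM -mulmxA mxE sumr_ge0 // => i _.
by rewrite !mxE mulrC mul_conjC_ge0.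
Qed.

Lemma psd1 n : psd (1%:M : 'M[C]_n).
Proof. by have := psd_gram (1%:M : 'M[C]_n); rewrite mulmx1 adjmx1. Qed.

Lemma psd_proj n (P : 'M[C]_n) : P^t* = P -> P *m P = P -> psd P.
Proof. by move=> aP PP; have := psd_gram P; rewrite aP PP. Qed.

Lemma psd_diag n (A : 'M[C]_n) i : psd A -> 0 <= A i i.
Proof.
move=> /(_ (delta_mx i 0)); rewrite adjmx_delta -rowE -colE.
by rewrite !mxE.
Qed.

Lemma psd_trace n (A : 'M[C]_n) : psd A -> 0 <= \tr A.
Proof. by move=> pA; apply: sumr_ge0 => i _; apply: psd_diag. Qed.

(** Polarization: the quadratic form is real at [e_i + c e_j]; the choices [c = 1] and [c = 'i] give
    the sum and the difference of the two off-diagonal entries. *)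
Lemma psd_hermitian n (A : 'M[C]_n) : psd A -> A^t* = A.
Proof.
move=> pA; apply/matrixP => j i; rewrite !mxE.
pose q (c : C) := ((delta_mx i 0 + c *: delta_mx j 0)^t* *m A *m
  (delta_mx i 0 + c *: delta_mx j 0) : 'M[C]_1) 0 0.
have qE c : q c = A i i + c * A i j + c^* * A j i + c^* * c * A j j.
  rewrite /q adjmxD adjmxZ !adjmx_delta mulmxDl -scalemxAl -!rowE.
  by rewrite mulmxDr -scalemxAr -!colE !mxE; ring.
have q_real c : (q c)^* = q c by apply/CrealP/ger0_real/pA.
have Aii k : (A k k)^* = A k k by apply/CrealP/ger0_real/psd_diag.
have eq1 : (A i j)^* + (A j i)^* = A i j + A j i.
  have := q_real 1; rewrite qE !(rmorphD, rmorphM) /= !rmorph1 !Aii => e.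
  have -> : (A i j)^* + (A j i)^* = A i i + 1 * (A i j)^* + 1 * (A j i)^* +
    1 * 1 * A j j - A i i - A j j by ring.
  by rewrite e; ring.
have eq2 : (A j i)^* - (A i j)^* = A i j - A j i.
  apply: (mulfI (neq0Ci C)).
  have := q_real 'i; rewrite qE !(rmorphD, rmorphM) /= !Aii conjCK conjCi => e.
  have -> : 'i * ((A j i)^* - (A i j)^*) = A i i + - 'i * (A i j)^* +
    'i * (A j i)^* + 'i * - 'i * A j j - A i i - 'i * - 'i * A j j by ring.
  by rewrite e; ring.
have two0 : (2%:R : C) != 0 by rewrite pnatr_eq0.
apply: (mulfI two0).
have -> : 2%:R * (A i j)^* = ((A i j)^* + (A j i)^*) - ((A j i)^* - (A i j)^*).
  by ring.
by rewrite eq1 eq2; ring.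
Qed.

(** Spectral theorem: [L] is the root of the diagonal of eigenvalues times the diagonalizing unitary
    [P]. *)
Lemma psd_factor n (A : 'M[C]_n) : psd A -> exists L : 'M[C]_n, A = L^t* *m L.
Proof.
move=> pA; have nA : A \is normalmx.
  by apply/normalmxP; rewrite psd_hermitian.
have uP := spectral_unitarymx A.
move/orthomx_spectralP: nA; rewrite invmx_unitary //.
set P := spectralmx A in uP *; set d := spectral_diag A => eA.
(* The eigenvalues are the diagonal entries of [A] conjugated by [P]. *)
have d_ge0 i : 0 <= d 0 i.
  have := @psd_conj _ _ P A pA; rewrite eA !mulmxA (unitarymxP uP) mul1mx.
  rewrite -mulmxA (unitarymxP uP) mulmx1 => /(@psd_diag _ _ i).
  by rewrite mxE eqxx.
pose s := diag_mx (map_mx sqrtC d).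
exists (s *m P); rewrite adjmxM mulmxA -(mulmxA _ _ s) {1}eA; congr (_ *m _ *m _).
rewrite /s tr_diag_mx map_diag_mx mulmx_diag; congr diag_mx.
apply/rowP => i; rewrite !mxE.
rewrite [X in X * _]conj_Creal ?ger0_real ?sqrtC_ge0 //.
by rewrite -expr2 sqrtCK.
Qed.

Lemma psd_tens m n (A : 'M[C]_m) (B : 'M[C]_n) : psd A -> psd B -> psd (A *t B).
Proof.
move=> /psd_factor [L ->] /psd_factor [K ->].
by rewrite -tensmx_mul -adjmx_tens; apply: psd_gram.
Qed.

End Positivity.

(** * Tensor products and partial traces *)

Section Tensors.
Variable C : numClosedFieldType.

Lemma tensmxDl m n p q (A A' : 'M[C]_(m, n)) (B : 'M[C]_(p, q)) :
  (A + A') *t B = A *t B + A' *t B.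
Proof. by apply/matrixP => i j; rewrite !mxE mulrDl. Qed.

Lemma tensmxDr m n p q (A : 'M[C]_(m, n)) (B B' : 'M[C]_(p, q)) :
  A *t (B + B') = A *t B + A *t B'.
Proof. by apply/matrixP => i j; rewrite !mxE mulrDr. Qed.

Lemma tensmxZl m n p q c (A : 'M[C]_(m, n)) (B : 'M[C]_(p, q)) :
  (c *: A) *t B = c *: (A *t B).
Proof. by apply/matrixP => i j; rewrite !mxE mulrA. Qed.

Lemma tensmxZr m n p q c (A : 'M[C]_(m, n)) (B : 'M[C]_(p, q)) :
  A *t (c *: B) = c *: (A *t B).
Proof. by apply/matrixP => i j; rewrite !mxE mulrCA. Qed.

Lemma tensmxBl m n p q (A A' : 'M[C]_(m, n)) (B : 'M[C]_(p, q)) :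
  (A - A') *t B = A *t B - A' *t B.
Proof. by rewrite tensmxDl -scaleN1r tensmxZl scaleN1r. Qed.

Lemma tensmxBr m n p q (A : 'M[C]_(m, n)) (B B' : 'M[C]_(p, q)) :
  A *t (B - B') = A *t B - A *t B'.
Proof. by rewrite tensmxDr -scaleN1r tensmxZr scaleN1r. Qed.

Lemma tensmx_sumr m n p q (I : Type) (r : seq I) (A : 'M[C]_(m, n))
    (F : I -> 'M[C]_(p, q)) :
  A *t (\sum_(i <- r) F i) = \sum_(i <- r) A *t F i.
Proof.
elim/big_rec2: _ => [|i y z _ <-]; [exact: tensmx0|exact: tensmxDr].
Qed.

Lemma tensmx_suml m n p q (I : Type) (r : seq I) (B : 'M[C]_(p, q))
    (F : I -> 'M[C]_(m, n)) :
  (\sum_(i <- r) F i) *t B = \sum_(i <- r) F i *t B.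
Proof.
elim/big_rec2: _ => [|i y z _ <-]; [exact: tens0mx|exact: tensmxDl].
Qed.

Lemma mxtens_index_eq m n (i k : 'I_m) (j l : 'I_n) :
  (mxtens_index (i, j) == mxtens_index (k, l)) = (i == k) && (j == l).
Proof. by rewrite (can_eq (@mxtens_indexK m n)) xpair_eqE. Qed.

Lemma tensmx11 m n : (1%:M : 'M[C]_m) *t (1%:M : 'M[C]_n) = 1%:M.
Proof.
apply/matrixP => i j; case: (mxtens_indexP i) => i0 i1.
case: (mxtens_indexP j) => j0 j1.
by rewrite tensmxE !mxE mxtens_index_eq -natrM mulnb.
Qed.

Lemma tensmx_scalar m n (c d : C) : (c%:M : 'M_m) *t (d%:M : 'M_n) = (c * d)%:M.
Proof.
rewrite -[c%:M]scalemx1 -[d%:M]scalemx1 tensmxZl tensmxZr tensmx11.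
by rewrite scalerA scalemx1.
Qed.

Lemma mxtrace_tens m n (A : 'M[C]_m) (B : 'M[C]_n) : \tr (A *t B) = \tr A * \tr B.
Proof. by rewrite /mxtrace mulr_sum; apply: eq_bigr => i _; rewrite mxE. Qed.

Lemma blockB_tens a b (A : 'M[C]_a) (B : 'M[C]_b) i j :
  blockB (A *t B) i j = B i j *: A.
Proof. by apply/matrixP => p q; rewrite mxE tensmxE mxE mulrC. Qed.

Lemma sum_blockB a b (X : 'M[C]_(a * b)) :
  \sum_i \sum_j blockB X i j *t delta_mx i j = X.
Proof.
apply/matrixP => k l; case: (mxtens_indexP k) => p i.
case: (mxtens_indexP l) => q j.
rewrite summxE (bigD1 i) //= [X in _ + X]big1 => [|i' ne_i]; last first.
  by rewrite summxE big1 // => j' _; rewrite tensmxE !mxE eq_sym (negPf ne_i) mulr0.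
rewrite addr0 summxE (bigD1 j) //= [X in _ + X]big1 => [|j' ne_j]; last first.
  by rewrite tensmxE !mxE (eq_sym j) (negPf ne_j) andbF mulr0.
by rewrite addr0 tensmxE !mxE !eqxx mulr1.
Qed.

(** Product operators span additively, the scalars being absorbed into a factor. Linear identities
    on a bipartite system are thereby checked on products alone. *)
Lemma tensmx_ind a b (P : 'M[C]_(a * b) -> Prop) :
  (forall X Y, P X -> P Y -> P (X + Y)) -> (forall A B, P (A *t B)) ->
  forall X, P X.
Proof.
move=> PD Pt X; rewrite -(sum_blockB X).
have P0 : P 0 by rewrite -(tens0mx (m := a) (n := a) (0 : 'M[C]_b)).
by elim/big_ind: _ => // i _; elim/big_ind: _.
Qed.

Lemma blockBP a b c (X Y : 'M[C]_(a * b)) i j :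
  blockB (c *: X + Y) i j = c *: blockB X i j + blockB Y i j.
Proof. by apply/matrixP => p q; rewrite !mxE. Qed.

Fact ptrA_is_linear a b : linear (@ptrA C a b).
Proof.
move=> c X Y; apply/matrixP => i j.
by rewrite !mxE blockBP linearP.
Qed.
HB.instance Definition _ a b := GRing.isLinear.Build C 'M[C]_(a * b) 'M[C]_b
  *:%R (@ptrA C a b) (@ptrA_is_linear a b).

Lemma ptrA_tens a b (A : 'M[C]_a) (B : 'M[C]_b) : ptrA (A *t B) = \tr A *: B.
Proof. by apply/matrixP => i j; rewrite !mxE blockB_tens mxtraceZ mulrC. Qed.

Lemma mxtrace_ptrA a b (X : 'M[C]_(a * b)) : \tr (ptrA X) = \tr X.
Proof.
elim/tensmx_ind: X => [X Y eX eY|A B]; first by rewrite !linearD /= eX eY.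
by rewrite ptrA_tens mxtraceZ mxtrace_tens.
Qed.

Lemma mxtrace_mul_tens1 a b (X : 'M[C]_(a * b)) (B : 'M[C]_b) :
  \tr (X *m (1%:M *t B)) = \tr (ptrA X *m B).
Proof.
elim/tensmx_ind: X => [X Y eX eY|A B'].
  by rewrite mulmxDl !linearD /= mulmxDl linearD /= eX eY.
by rewrite tensmx_mul mulmx1 mxtrace_tens ptrA_tens -scalemxAl mxtraceZ.
Qed.

Fact isochan_is_linear n m (U : 'M[C]_(m, n)) : linear (isochan U).
Proof.
by move=> c X Y; rewrite /isochan mulmxDr mulmxDl -scalemxAr -scalemxAl.
Qed.
HB.instance Definition _ n m (U : 'M[C]_(m, n)) := GRing.isLinear.Build
  C 'M[C]_n 'M[C]_m *:%R (isochan U) (isochan_is_linear U).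

Lemma ptrA_conj a a' b b' (V : 'M[C]_(a', a)) (W : 'M[C]_(b', b))
    (X : 'M[C]_(a * b)) :
  isometry V -> ptrA (isochan (V *t W) X) = isochan W (ptrA X).
Proof.
move=> isoV; elim/tensmx_ind: X => [X Y eX eY|A B].
  by rewrite !linearD /= eX eY.
rewrite /isochan adjmx_tens !tensmx_mul !ptrA_tens -scalemxAr -scalemxAl.
by rewrite mxtrace_mulC mulmxA isoV mul1mx.
Qed.

Section ActA.
Variables (a a' b : nat) (N : {linear 'M[C]_a -> 'M[C]_a'}).

Fact actA_is_linear : linear (@actA C a a' b N).
Proof.
move=> c X Y; rewrite /actA scaler_sumr -big_split /=; apply: eq_bigr => i _.
rewrite scaler_sumr -big_split /=; apply: eq_bigr => j _.
rewrite blockBP linearP.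
by rewrite tensmxDl tensmxZl.
Qed.
HB.instance Definition _ := GRing.isLinear.Build C 'M[C]_(a * b) 'M[C]_(a' * b)
  *:%R (@actA C a a' b N) actA_is_linear.

Lemma actA_tens (A : 'M[C]_a) (B : 'M[C]_b) : actA N (A *t B) = N A *t B.
Proof.
rewrite /actA [in RHS](matrix_sum_delta B) tensmx_sumr; apply: eq_bigr => i _.
rewrite tensmx_sumr; apply: eq_bigr => j _.
by rewrite blockB_tens linearZ tensmxZl tensmxZr.
Qed.

Lemma ptrA_actA (X : 'M[C]_(a * b)) :
  trace_preserving N -> ptrA (actA N X) = ptrA X.
Proof.
move=> tpN; elim/tensmx_ind: X => [X Y eX eY|A B].
  by rewrite !linearD /= eX eY.
by rewrite actA_tens !ptrA_tens tpN.
Qed.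

End ActA.

Lemma isochan_tens m n p q (V : 'M[C]_(m, n)) (W : 'M[C]_(p, q)) A B :
  isochan (V *t W) (A *t B) = isochan V A *t isochan W B.
Proof. by rewrite /isochan adjmx_tens !tensmx_mul. Qed.

Lemma isochan1 n (X : 'M[C]_n) : isochan 1%:M X = X.
Proof. by rewrite /isochan adjmx1 mul1mx mulmx1. Qed.

(** Turns the blockwise extension into a single conjugation, to which the facts on isometries and
    positivity apply. *)
Lemma actA_isochan a a' b (V : 'M[C]_(a', a)) (X : 'M[C]_(a * b)) :
  actA (isochan V) X = isochan (V *t 1%:M) X.
Proof.
elim/tensmx_ind: X => [X Y eX eY|A B]; first by rewrite !linearD /= eX eY.
by rewrite actA_tens isochan_tens isochan1.
Qed.

Lemma isometry_tens m n p q (V : 'M[C]_(m, n)) (W : 'M[C]_(p, q)) :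
  isometry V -> isometry W -> isometry (V *t W).
Proof.
by rewrite /isometry adjmx_tens tensmx_mul => -> ->; exact: tensmx11.
Qed.

Lemma isometry1 n : isometry (1%:M : 'M[C]_n).
Proof. by rewrite /isometry adjmx1 mulmx1. Qed.

Lemma density_isochan m n (V : 'M[C]_(m, n)) X :
  isometry V -> density X -> density (isochan V X).
Proof.
move=> isoV [pX tX]; split; first exact: psd_conj.
by rewrite /isochan mxtrace_mulC mulmxA isoV mul1mx.
Qed.

Lemma density_tens m n (A : 'M[C]_m) (B : 'M[C]_n) :
  density A -> density B -> density (A *t B).
Proof.
by move=> [pA tA] [pB tB]; split; [exact: psd_tens|rewrite mxtrace_tens tA tB mul1r].
Qed.

Lemma density_uniform n : (0 < n)%N -> density (uniform C n).
Proof.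
move=> n0; rewrite /uniform; split.
  by rewrite -scalemx1; apply: psdZ; [rewrite invr_ge0 ler0n|exact: psd1].
by rewrite mxtrace_scalar -[LHS]mulr_natr mulVf // pnatr_eq0 -lt0n.
Qed.

Lemma psd_ptrA a b (X : 'M[C]_(a * b)) : psd X -> psd (ptrA X).
Proof.
move=> pX.
(* [K p] is [<p| (x) I]; these are the Kraus operators of the partial trace. *)
pose K p : 'M[C]_(b, a * b) := \matrix_(i, k) (k == mxtens_index (p, i))%:R.
have -> : ptrA X = \sum_p K p *m X *m (K p)^t*.
  apply/matrixP => i j; rewrite summxE mxE; apply: eq_bigr => p _.
  rewrite !mxE (bigD1 (mxtens_index (p, j))) //= big1 ?addr0 => [|l ne_l].
    rewrite !mxE eqxx rmorph1 mulr1 (bigD1 (mxtens_index (p, i))) //= big1.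
      by rewrite mxE eqxx mul1r addr0.
    by move=> k ne_k; rewrite mxE (negPf ne_k) mul0r.
  by rewrite !mxE (negPf ne_l) rmorph0 mulr0.
by apply: psd_sum => p; apply: psd_conj.
Qed.

Lemma density_ptrA a b (X : 'M[C]_(a * b)) : density X -> density (ptrA X).
Proof. by case=> pX tX; split; [exact: psd_ptrA|rewrite mxtrace_ptrA]. Qed.

(** * Reordering of tensor factors *)

Section Reorder.
Variables a b a' b' : nat.
Local Notation reorder := (@reorder C a b a' b').

Fact reorder_is_linear : linear reorder.
Proof. by move=> c X Y; apply/matrixP => k l; rewrite !mxE. Qed.
HB.instance Definition _ := GRing.isLinear.Build C
  'M[C]_((a * b) * (a' * b')) 'M[C]_((a * a') * (b * b')) *:%R
  reorder reorder_is_linear.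

Lemma reorder_tens A B A' B' :
  reorder ((A *t B) *t (A' *t B')) = (A *t A') *t (B *t B').
Proof.
by apply/matrixP => k l; rewrite !mxE !mxtens_indexK /= mulrACA.
Qed.

Lemma tensmx_ind4 (P : 'M[C]_((a * b) * (a' * b')) -> Prop) :
  (forall X Y, P X -> P Y -> P (X + Y)) ->
  (forall A B A' B', P ((A *t B) *t (A' *t B'))) -> forall X, P X.
Proof.
move=> PD Pt X; elim/tensmx_ind: X => // X Y.
elim/tensmx_ind: X => [X1 X2 P1 P2|A B]; first by rewrite tensmxDl; apply: PD.
by elim/tensmx_ind: Y => [Y1 Y2 P1 P2|A' B'] //; rewrite tensmxDr; apply: PD.
Qed.

Lemma reorder1 : reorder 1%:M = 1%:M.
Proof. by rewrite -!tensmx11 reorder_tens. Qed.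

(** Reordering only permutes the basis. Multiplicativity is what carries Gram factorizations, hence
    positivity, through it. *)
Lemma reorderM X Y : reorder (X *m Y) = reorder X *m reorder Y.
Proof.
elim/tensmx_ind4: X => [X1 X2 e1 e2|A B A' B'].
  by rewrite mulmxDl !linearD /= mulmxDl e1 e2.
elim/tensmx_ind4: Y => [Y1 Y2 e1 e2|D E D' E'].
  by rewrite !linearD /= e1 e2.
by rewrite !(tensmx_mul, reorder_tens).
Qed.

Lemma mxtrace_reorder X : \tr (reorder X) = \tr X.
Proof.
elim/tensmx_ind4: X => [X1 X2 e1 e2|A B A' B'].
  by rewrite !linearD /= e1 e2.
by rewrite reorder_tens !mxtrace_tens mulrACA.
Qed.

Lemma psd_reorder X : psd X -> psd (reorder X).
Proof.
case/psd_factor => L ->; rewrite reorderM.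
have -> : reorder (L^t*) = (reorder L)^t* by apply/matrixP => i j; rewrite !mxE.
exact: psd_gram.
Qed.

Lemma density_reorder X : density X -> density (reorder X).
Proof. by case=> pX tX; split; [exact: psd_reorder|rewrite mxtrace_reorder]. Qed.

Lemma ptrA_reorder X Y : ptrA (reorder (X *t Y)) = ptrA X *t ptrA Y.
Proof.
elim/tensmx_ind: X => [X1 X2 e1 e2|A B].
  by rewrite tensmxDl !linearD /= tensmxDl e1 e2.
elim/tensmx_ind: Y => [Y1 Y2 e1 e2|A' B'].
  by rewrite tensmxDr !linearD /= tensmxDr e1 e2.
by rewrite reorder_tens !ptrA_tens mxtrace_tens tensmxZl tensmxZr scalerA.
Qed.

End Reorder.
End Tensors.

(** * Conditionally mixing channels *)

Section Channels.
Variable C : numClosedFieldType.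

Lemma isochan_comp m n p (U : 'M[C]_(p, m)) (V : 'M[C]_(m, n)) X :
  isochan U (isochan V X) = isochan (U *m V) X.
Proof. by rewrite /isochan adjmxM !mulmxA. Qed.

Lemma isometry_leq m n (U : 'M[C]_(m, n)) : isometry U -> (n <= m)%N.
Proof. exact: mulmx1_min. Qed.

Lemma channel_isochan m n (U : 'M[C]_(m, n)) : isometry U -> channel (isochan U).
Proof.
move=> isoU; split=> [k X pX|X]; first by rewrite actA_isochan; apply: psd_conj.
by rewrite /isochan mxtrace_mulC mulmxA isoU mul1mx.
Qed.

Lemma conditionally_mixing_isochan a b b' (W : 'M[C]_(b', b)) :
  isometry W ->
  conditionally_mixing (isochan ((1%:M : 'M_a) *t W) : {linear _ -> _}).
Proof.
move=> isoW; split.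
- exact/channel_isochan/isometry_tens/isoW/isometry1.
- move=> rho drho; exists (isochan W rho); first exact: density_isochan.
  by rewrite /= isochan_tens isochan1.
- by move=> M [_ tpM] X /=; rewrite !ptrA_conj ?ptrA_actA //; apply: isometry1.
Qed.

(** [V] serves as the embedding of the source, the identity as that of the target, and [1 (x) W] as
    the mixing channel. *)
Lemma cond_majorizes_isochan a b a' b' (V : 'M[C]_(a', a)) (W : 'M[C]_(b', b))
    (rho : 'M[C]_(a * b)) :
  isometry V -> isometry W -> cond_majorizes rho (isochan (V *t W) rho).
Proof.
move=> isoV isoW; exists a', V, 1%:M, (isochan (1%:M *t W)); split=> //.
- by rewrite geq_max leqnn (isometry_leq isoV).
- exact: isometry1.
- exact: conditionally_mixing_isochan.
- rewrite /= !actA_isochan tensmx11 isochan1 isochan_comp tensmx_mul.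
  by rewrite mul1mx mulmx1.
Qed.

(** * Measure-and-prepare channels *)

Section TestPrepare.
Variables (a b b' : nat) (M : 'M[C]_(a * b)) (w1 w2 : 'M[C]_(a * b')).

(** [M] and [1%:M - M] are the effects of a two-outcome measurement, whose outcome selects the state
    to prepare. *)
Definition test_prepare (X : 'M[C]_(a * b)) : 'M[C]_(a * b') :=
  \tr (M *m X) *: w1 + \tr ((1%:M - M) *m X) *: w2.

Fact test_prepare_is_linear : linear test_prepare.
Proof.
move=> c X Y; rewrite /test_prepare !mulmxDr -!scalemxAr !mxtraceD !mxtraceZ.
by rewrite !scalerDl -!scalerA scalerDr addrACA.
Qed.
HB.instance Definition _ := GRing.isLinear.Build C 'M[C]_(a * b) 'M[C]_(a * b')
  *:%R test_prepare test_prepare_is_linear.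

Lemma test_prepareE X :
  test_prepare X = \tr (M *m X) *: w1 + (\tr X - \tr (M *m X)) *: w2.
Proof. by rewrite /test_prepare mulmxBl mul1mx linearB. Qed.

Lemma channel_test_prepare : psd M -> psd (1%:M - M) ->
  density w1 -> density w2 -> channel test_prepare.
Proof.
move=> pM pM' [pw1 tw1] [pw2 tw2]; split=> [k X pX|X]; last first.
  by rewrite /= test_prepareE mxtraceD !mxtraceZ tw1 tw2 !mulr1 addrC subrK.
have [L1 eL1] := psd_factor pM; have [L2 eL2] := psd_factor pM'.
(* With each effect in Gram form, its expectation on the input is the partial trace of a conjugation
   by [L1] or [L2]. The extended map is thus a sum of products of positive operators. *)
suff -> : actA test_prepare X = w1 *t ptrA (isochan (L1 *t 1%:M) X) +
                                w2 *t ptrA (isochan (L2 *t 1%:M) X).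
  by apply: psdD; apply: psd_tens => //; apply/psd_ptrA/psd_conj.
elim/tensmx_ind: X {pX} => [X Y eX eY|A B].
  by rewrite !linearD /= eX eY !tensmxDr addrACA.
rewrite actA_tens /= /test_prepare eL2 eL1 !isochan_tens !ptrA_tens !isochan1.
rewrite tensmxDl !tensmxZl !tensmxZr /isochan.
by congr (_ *: _ + _ *: _); rewrite -mulmxA mxtrace_mulC.
Qed.

(** Semi-causality holds because both prepared states have the same marginal, so the output marginal
    depends on the input only through its trace. Unitality holds because every input [u (x) sigma]
    passes the test with the same probability [p], and the [p]-average of the prepared states is
    uniform on A. *)
Lemma conditionally_mixing_test_prepare p : psd M -> psd (1%:M - M) ->
  density w1 -> density w2 -> ptrA w2 = ptrA w1 ->
  (forall sigma, density sigma -> \tr (M *m (uniform C a *t sigma)) = p) ->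
  p *: w1 + (1 - p) *: w2 = uniform C a *t ptrA w1 -> (0 < a)%N ->
  conditionally_mixing (test_prepare : {linear _ -> _}).
Proof.
move=> pM pM' dw1 dw2 eqw Mp eqp a0; split.
- exact: channel_test_prepare.
- move=> rho drho; exists (ptrA w1); first exact: density_ptrA.
  rewrite /= test_prepareE Mp // mxtrace_tens (proj2 drho).
  by rewrite (proj2 (density_uniform C a0)) mulr1.
- have ptr X : ptrA (test_prepare X) = \tr X *: ptrA w1.
    by rewrite test_prepareE !linearD /= !linearZ /= eqw -scalerDl addrC subrK.
  by move=> N [_ tpN] X; rewrite /= !ptr -!(mxtrace_ptrA, ptrA_actA X tpN).
Qed.

End TestPrepare.

(* The channel tests [M] and prepares [sigma] on success; on failure it prepares
   whatever completes the average over outcomes to a uniform state on A. *)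
Lemma cond_majorizes_test a b a' b' a2 (rho : 'M[C]_(a * b))
    (sigma : 'M[C]_(a' * b')) (V : 'M[C]_(a2, a)) (U : 'M[C]_(a2, a'))
    (M : 'M[C]_(a2 * b)) (p : C) :
  let w := actA (isochan U) sigma in
  let t := uniform C a2 *t ptrA sigma in
  isometry V -> isometry U -> (0 < a2)%N -> density rho -> density sigma ->
  psd M -> psd (1%:M - M) -> \tr (M *m actA (isochan V) rho) = 1 ->
  (forall tau, density tau -> \tr (M *m (uniform C a2 *t tau)) = p) ->
  p < 1 /\ psd (t - p *: w) \/ p = 1 /\ w = t ->
  cond_majorizes rho sigma.
Proof.
move=> w t isoV isoU a20 drho dsigma pM pM' Mrho Mp wt.
have dw : density w.
  rewrite /w actA_isochan; apply: density_isochan dsigma.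
  exact/isometry_tens/isometry1/isoU.
have dt : density t.
  by apply: density_tens; [exact: density_uniform|exact: density_ptrA].
have ptrt : ptrA t = ptrA sigma.
  by rewrite ptrA_tens (proj2 (density_uniform C a20)) scale1r.
have ptrw : ptrA w = ptrA sigma.
  by rewrite /w actA_isochan ptrA_conj ?isochan1.
(* For [p < 1] the failure state is obtained by solving the averaging equation. For [p = 1] it has
   weight zero, and [t] is a choice with the right marginal. *)
have [w2 [dw2 ptrw2 eqt]] : exists w2,
    [/\ density w2, ptrA w2 = ptrA w & p *: w + (1 - p) *: w2 = t].
  case: wt => [[p1 ptw]|[-> wt]]; last first.
    by exists t; rewrite ptrw ptrt wt scale1r subrr scale0r addr0.
  have p1' : 1 - p != 0 by rewrite subr_eq0 eq_sym lt_eqF.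
  exists ((1 - p)^-1 *: (t - p *: w)); split.
  - split; first by apply: psdZ ptw; rewrite invr_ge0 subr_ge0 ltW.
    by rewrite mxtraceZ linearB /= mxtraceZ (proj2 dw) (proj2 dt) mulr1 mulVf.
  - rewrite linearZ /= linearB /= linearZ /= ptrt ptrw -{1}[ptrA sigma]scale1r.
    by rewrite -scalerBl scalerA mulVf // scale1r.
  - by rewrite scalerA divff // scale1r addrC subrK.
exists a2, V, U, (test_prepare M w w2); split=> //.
- by rewrite geq_max (isometry_leq isoV) (isometry_leq isoU).
- by apply: (conditionally_mixing_test_prepare pM pM' dw dw2 ptrw2 Mp); rewrite ?ptrw.
- have [_ tr1] : density (actA (isochan V) rho).
    rewrite actA_isochan; apply: density_isochan drho.
    exact/isometry_tens/isometry1/isoV.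
  by rewrite /= test_prepareE Mrho tr1 scale1r subrr scale0r addr0.
Qed.

End Channels.

(** * Majorization of uniform and pure states *)

Section States.
Variable C : numClosedFieldType.

(** Operator Cauchy-Schwarz: the difference is half the sum over all pairs [p], [q] of the
    conjugations of [X] by [K p - K q]. *)
Lemma psd_isochan_sum n m (X : 'M[C]_n) k (K : 'I_k -> 'M[C]_(m, n)) :
  psd X -> psd (k%:R *: (\sum_p isochan (K p) X) - isochan (\sum_p K p) X).
Proof.
move=> pX.
have -> : k%:R *: (\sum_p isochan (K p) X) - isochan (\sum_p K p) X =
    2%:R^-1 *: \sum_p \sum_q isochan (K p - K q) X.
  pose B (U V : 'M[C]_(m, n)) := U *m X *m V^t*.
  have -> : \sum_p \sum_q isochan (K p - K q) X =
      \sum_p \sum_q (B (K p) (K p) + B (K q) (K q) - (B (K p) (K q) + B (K q) (K p))).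
    apply: eq_bigr => p _; apply: eq_bigr => q _; rewrite /isochan /B.
    rewrite adjmxD adjmxN mulmxBl mulmxDr !mulmxBl !mulmxN opprK.
    by rewrite [- _ + _]addrC addrACA -opprD [X in - X]addrC.
  have BK : \sum_p \sum_q B (K p) (K q) = isochan (\sum_p K p) X.
    rewrite /isochan !mulmx_suml; apply: eq_bigr => p _.
    by rewrite adjmx_sum mulmx_sumr.
  have D1 : \sum_(p < k) \sum_(q < k) B (K p) (K p) = k%:R *: \sum_p isochan (K p) X.
    rewrite scaler_sumr; apply: eq_bigr => p _.
    by rewrite sumr_const card_ord scaler_nat.
  transitivity (2%:R^-1 *: (2%:R *: (k%:R *: (\sum_p isochan (K p) X) -
                                     isochan (\sum_p K p) X))).
    by rewrite scalerA mulVf ?pnatr_eq0 // scale1r.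
  congr (_ *: _); under [RHS]eq_bigr do rewrite sumrB !big_split /=.
  rewrite sumrB !big_split /= D1 [X in _ + X - _]exchange_big /= D1.
  rewrite [X in _ - (_ + X)]exchange_big /= BK.
  by rewrite !scaler_nat !mulr2n addrACA opprD.
apply: psdZ; first by rewrite invr_ge0 ler0n.
by do 2!(apply: psd_sum => ?); apply: psd_conj.
Qed.

Lemma delta_mx_mul m n p q (A : 'M[C]_(n, p)) (i : 'I_m) j k (l : 'I_q) :
  delta_mx i j *m A *m delta_mx k l = A j k *: delta_mx i l.
Proof.
apply/matrixP => s t; rewrite !mxE (bigD1 k) //= big1 ?addr0 => [|r ne_r].
  rewrite !mxE eqxx (bigD1 j) //= big1 ?addr0 => [|r ne_r]; last first.
    by rewrite mxE (negPf ne_r) andbF mul0r.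
  by rewrite mxE eqxx andbT; case: (s == i); case: (t == l);
    rewrite ?(mul0r, mulr0, mul1r, mulr1).
by rewrite [X in _ * X]mxE (negPf ne_r) mulr0.
Qed.

(** The matrix units of A are Kraus operators of the unnormalized depolarizing map. *)
Lemma tens1_ptrA a b (X : 'M[C]_(a * b)) :
  (1%:M : 'M_a) *t ptrA X =
  \sum_p \sum_r isochan ((delta_mx p r : 'M_a) *t (1%:M : 'M_b)) X.
Proof.
elim/tensmx_ind: X => [X Y eX eY|A B].
  rewrite linearD /= tensmxDr eX eY -big_split; apply: eq_bigr => p _ /=.
  by rewrite -big_split; apply: eq_bigr => r _; rewrite /= linearD.
rewrite ptrA_tens tensmxZr -tensmxZl mx1_sum_delta scaler_sumr tensmx_suml.
apply: eq_bigr => p _.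
rewrite /mxtrace scaler_suml tensmx_suml; apply: eq_bigr => r _.
by rewrite isochan_tens isochan1 /isochan adjmx_delta delta_mx_mul.
Qed.

(* Cauchy-Schwarz over the [a] diagonal blocks of X, each of which is one of the
   terms of [tens1_ptrA]. *)
Lemma loewner_le_ptrA a b (X : 'M[C]_(a * b)) :
  psd X -> loewner_le X (a%:R *: (1%:M *t ptrA X)).
Proof.
move=> pX; pose K (p : 'I_a) : 'M[C]_(a * b) := delta_mx p p *t 1%:M.
have K1 : \sum_p K p = 1%:M.
  rewrite -tensmx11 mx1_sum_delta; apply/matrixP => i j.
  by rewrite summxE !mxE summxE mulr_suml; apply: eq_bigr => p _; rewrite !mxE.
have := psd_isochan_sum K pX; rewrite K1 isochan1 /loewner_le => pK.
rewrite tens1_ptrA.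
(* The terms with [r = p] are those controlled by Cauchy-Schwarz; the others are positive and only
   help. *)
have -> : a%:R *: (\sum_(p < a) \sum_(r < a) isochan (delta_mx p r *t 1%:M) X) - X =
    a%:R *: (\sum_(p < a) \sum_(r < a | r != p)
      isochan ((delta_mx p r : 'M_a) *t (1%:M : 'M_b)) X) +
    (a%:R *: (\sum_p isochan (K p) X) - X).
  rewrite addrA -scalerDr -big_split /=; congr (_ *: _ - _).
  by apply: eq_bigr => p _; rewrite (bigD1 p) //= addrC.
apply: psdD pK; apply: psdZ; first exact: ler0n.
apply: psd_sum => p; rewrite big_mkcond; apply: psd_sum => r.
by case: ifP => _; [apply: psd_conj|exact: psd0].
Qed.

Lemma loewner_le_scale n (X Y : 'M[C]_n) (c d : C) :
  psd Y -> c <= d -> loewner_le X (c *: Y) -> loewner_le X (d *: Y).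
Proof.
move=> pY le_cd leX; rewrite /loewner_le -(subrK (c *: Y) (d *: Y)) -addrA.
by apply: psdD leX; rewrite -scalerBl; apply: psdZ; rewrite ?subr_ge0.
Qed.

Lemma psd_isometry_compl m n (U : 'M[C]_(m, n)) :
  isometry U -> psd (1%:M - U *m U^t*).
Proof.
move=> isoU; apply: psd_proj.
  by rewrite adjmxD adjmxN adjmx1 adjmxM trmxCK.
rewrite mulmxBl mul1mx mulmxBr mulmx1 mulmxA -(mulmxA U) isoU mulmx1.
by rewrite subrr subr0.
Qed.

Lemma isometry_pid m n : (n <= m)%N -> isometry (pid_mx n : 'M[C]_(m, n)).
Proof.
move=> le_nm; rewrite /isometry tr_pid_mx map_pid_mx mul_pid_mx minnn.
by rewrite (minn_idPr le_nm) pid_mx_1.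
Qed.

(** The projector [V V^t*] accepts [u_m] surely and the uniform state of dimension [a * n] with
    probability [m / (a * n)], which is below 1 by the strict bound on [m]. Up to reordering, the
    positivity asked of the failure state is the Loewner hypothesis scaled by that probability and
    tensored with [u_n]. *)
Lemma cond_majorizes_uniform a b m n (rho : 'M[C]_(a * b)) :
  (0 < m)%N -> (0 < n)%N -> (m < a * n)%N -> density rho ->
  loewner_le rho ((n%:R / m%:R) *: (1%:M *t ptrA rho)) ->
  cond_majorizes (uniform C m *t (1%:M : 'M_1))
                 (reorder (rho *t (uniform C n *t (1%:M : 'M_1)))).
Proof.
move=> m0 n0 ltm drho le_rho.
have d1 : density (1%:M : 'M[C]_1) by split; [exact: psd1|rewrite mxtrace1].
have isoV := isometry_pid (ltnW ltm); set V := pid_mx m in isoV.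
have an0 : (0 < a * n)%N by apply: leq_ltn_trans ltm.
have [mC nC aC] : [/\ m%:R != 0 :> C, n%:R != 0 :> C & a%:R != 0 :> C].
  by rewrite !pnatr_eq0 -!lt0n m0 n0; move: an0; rewrite muln_gt0 => /andP[->].
have trV (s : 'M[C]_(a * n)) : \tr ((V *m V^t*) *m s) = \tr (V^t* *m s *m V).
  by rewrite -mulmxA mxtrace_mulC.
apply: (@cond_majorizes_test _ _ _ _ _ (a * n) _ _ V 1%:M
  ((V *m V^t*) *t 1%:M) (m%:R / (a * n)%:R)) => //.
- exact: isometry1.
- by apply: density_tens d1; apply: density_uniform.
- by apply: density_reorder; do 2!apply: density_tens => //; apply: density_uniform.
- by apply: psd_tens (@psd1 _ _); have := psd_gram (V^t*); rewrite trmxCK.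
- rewrite -tensmx11 -tensmxBl; apply: psd_tens (@psd1 _ _).
  exact: psd_isometry_compl.
- rewrite actA_isochan isochan_tens isochan1 tensmx_mul mxtrace_tens mul1mx.
  rewrite mxtrace1 mulr1 trV /isochan !mulmxA isoV mul1mx -mulmxA isoV mulmx1.
  by rewrite (proj2 (density_uniform C m0)).
- move=> tau [_ ttau]; rewrite tensmx_mul mul1mx mxtrace_tens ttau mulr1.
  by rewrite /uniform mul_mx_scalar mxtraceZ mxtrace_mulC isoV mxtrace1 mulrC.
- left; split.
    by rewrite ltr_pdivrMr ?ltr0n // mul1r ltr_nat.
  rewrite actA_isochan tensmx11 isochan1 ptrA_reorder ptrA_tens.
  rewrite (proj2 (density_uniform C n0)) scale1r.
  have -> : uniform C (a * n) *t (ptrA rho *t 1%:M) =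
      reorder ((a%:R^-1 *: (1%:M *t ptrA rho)) *t (uniform C n *t (1%:M : 'M_1))).
    rewrite tensmxZl linearZ /= reorder_tens -tensmxZl; congr (_ *t _).
    by rewrite -tensmxZl scalemx1 tensmx_scalar /uniform natrM invfM.
  rewrite -linearZ -linearB /= -tensmxZl -tensmxBl; apply: psd_reorder.
  apply: psd_tens; last by case: (density_tens (density_uniform C n0) d1).
  have -> : a%:R^-1 *: (1%:M *t ptrA rho) - (m%:R / (a * n)%:R) *: rho =
      (m%:R / (a * n)%:R) *: ((n%:R / m%:R) *: (1%:M *t ptrA rho) - rho).
    by rewrite scalerBr scalerA natrM; congr (_ *: _ - _); field; rewrite ?aC ?nC ?mC.
  by apply: psdZ le_rho; rewrite divr_ge0 ?ler0n.
Qed.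

(** The target is the state of a one-dimensional system, which [U] embeds as the first basis vector.
    The test is [M] extended by the identity on the [k]-dimensional factor. *)
Lemma cond_majorizes_pure a b k (rho M : 'M[C]_(a * b)) :
  (0 < k)%N -> density rho -> psd M -> psd (1%:M - M) ->
  ptrA M = (k%:R^-1)%:M -> \tr (M *m rho) = 1 ->
  cond_majorizes (reorder (rho *t (uniform C k *t (1%:M : 'M_1))))
                 (uniform C 1 *t (1%:M : 'M_1)).
Proof.
move=> k0 drho pM pM' ptrM Mrho.
have d1 : density (1%:M : 'M[C]_1) by split; [exact: psd1|rewrite mxtrace1].
have a0 : (0 < a)%N.
  case: a rho M drho pM pM' ptrM Mrho => // rho M [_ +] *.
  rewrite /mxtrace big1 => [|[i lt_i]]; last by case: (notF lt_i).
  by move/eqP; rewrite eq_sym oner_eq0.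
have ak0 : (0 < a * k)%N by rewrite muln_gt0 a0.
have isoU := isometry_pid ak0; set U := pid_mx 1 in isoU.
have du := density_uniform C k0; have du1 := density_uniform C (ltn0Sn 0).
have pu : psd (1%:M *t 1%:M : 'M[C]_(k * 1)) by rewrite tensmx11; apply: psd1.
have wE : isochan U (uniform C 1) = U *m U^t*.
  by rewrite /isochan /uniform invr1 mulmx1.
apply: (@cond_majorizes_test _ _ _ _ _ (a * k) _ _ 1%:M U
  (reorder (M *t (1%:M *t (1%:M : 'M_1)))) (a * k)%:R^-1) => //.
- exact: isometry1.
- by apply: density_reorder; do 2!apply: density_tens => //.
- exact: density_tens.
- exact/psd_reorder/psd_tens.
- have -> : 1%:M - reorder (M *t ((1%:M : 'M_k) *t (1%:M : 'M_1))) =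
      reorder ((1%:M - M) *t ((1%:M : 'M_k) *t (1%:M : 'M_1))).
    by rewrite tensmxBl linearB /= !tensmx11 reorder1.
  exact/psd_reorder/psd_tens.
- rewrite actA_isochan !tensmx11 isochan1 -reorderM mxtrace_reorder tensmx_mul.
  by rewrite mul1mx !mxtrace_tens Mrho mxtrace1 mulr1 (proj2 du) mulr1.
(* Tracing out the [k]-dimensional factor yields [k], which cancels the [1 / k] of [ptrM]; only the
   normalization of the uniform state remains. *)
- move=> tau [_ ttau]; rewrite /uniform -[_^-1%:M]scalemx1 tensmxZl -scalemxAr mxtraceZ.
  rewrite mxtrace_mul_tens1 ptrA_reorder ptrM ptrA_tens mxtrace1.
  rewrite -[_^-1%:M]scalemx1 tensmxZl tensmxZr scalerA mulVf ?pnatr_eq0 -?lt0n //.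
  by rewrite scale1r tensmx11 mul1mx ttau mulr1.
- rewrite actA_tens /= wE ptrA_tens (proj2 du1) scale1r.
  (* When [a * k = 1] the test always succeeds, and the embedded pure state is itself uniform. *)
  have [ak1|ak1] := eqVneq (a * k)%N 1%N; [right|left].
    split; first by rewrite ak1 invr1.
    congr (_ *t _); rewrite tr_pid_mx map_pid_mx mul_pid_mx !minnn /uniform ak1.
    by rewrite pid_mx_1 invr1.
  split.
    by rewrite invf_lt1 ?ltr0n // ltr1n ltn_neqAle eq_sym ak1.
  rewrite -tensmxZl -tensmxBl /uniform -[_^-1%:M]scalemx1 -scalerBr.
  apply: psd_tens (@psd1 _ _); apply: psdZ; first by rewrite invr_ge0 ler0n.
  exact: psd_isometry_compl.
Qed.

End States.

(** * The maximally entangled state *)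

Section MaximallyEntangled.
Variable C : numClosedFieldType.

Lemma isochanM m n (V : 'M[C]_(m, n)) (X Y : 'M[C]_n) :
  isometry V -> isochan V X *m isochan V Y = isochan V (X *m Y).
Proof.
move=> isoV; rewrite /isochan !mulmxA; congr (_ *m _ *m _).
by rewrite -mulmxA isoV mulmx1.
Qed.

Lemma ptrA_Phi k : ptrA (Phi C k) = (k%:R^-1)%:M.
Proof.
pose e (i : 'I_k) : 'cV[C]_k := delta_mx i 0.
have sqrt_real : (sqrtC (k%:R : C))^-1^* = (sqrtC k%:R)^-1.
  by apply/conj_Creal/ger0_real; rewrite invr_ge0 sqrtC_ge0 ler0n.
rewrite /Phi /ket_Phi adjmxZ sqrt_real -scalemxAl -scalemxAr scalerA -invfM.
rewrite -expr2 sqrtCK linearZ /= -[RHS]scalemx1 mx1_sum_delta; congr (_ *: _).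
have eE i j : (e i *t e i) *m (e j *t e j)^t* = delta_mx i j *t delta_mx i j.
  rewrite [X in _ *m X](adjmx_tens (e j) (e j)).
  by rewrite (tensmx_mul (e i) (e i)) adjmx_delta mul_delta_mx.
have tr_delta i j : \tr (delta_mx i j : 'M[C]_k) = (i == j)%:R.
  rewrite -(mul_delta_mx (0 : 'I_1)) mxtrace_mulC mul_delta_mx_cond eq_sym.
  by case: eqP => _; rewrite ?mxtrace0 // mulr1n trace_mx11 mxE !eqxx.
rewrite mulmx_suml linear_sum; apply: eq_bigr => i _ /=.
rewrite adjmx_sum mulmx_sumr linear_sum (bigD1 i) //= big1 => [|j ne_ji].
  by rewrite eE ptrA_tens tr_delta eqxx scale1r addr0.
by rewrite eE ptrA_tens tr_delta eq_sym (negPf ne_ji) scale0r.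
Qed.

Lemma density_Phi k : (0 < k)%N -> density (Phi C k).
Proof.
move=> k0; split.
  by have := psd_gram ((ket_Phi C k)^t*); rewrite trmxCK.
by rewrite -mxtrace_ptrA ptrA_Phi; case: (density_uniform C k0).
Qed.

Lemma PhiM k : (0 < k)%N -> Phi C k *m Phi C k = Phi C k.
Proof.
move=> k0; have [_ tr1] := density_Phi k0.
rewrite {1 2}/Phi mulmxA -(mulmxA (ket_Phi C k)) [X in _ *m X *m _]mx11_scalar.
(* By cyclicity, the squared norm of the vector is the trace of [Phi]. *)
have -> : ((ket_Phi C k)^t* *m ket_Phi C k) 0 0 = 1.
  by rewrite -trace_mx11 mxtrace_mulC.
by rewrite mulmx1.
Qed.

(** * Local isometric images of the maximally entangled state *)

Section LocalImage.
Variables (a b k : nat) (V : 'M[C]_(a, k)) (W : 'M[C]_(b, k)).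
Hypotheses (k0 : (0 < k)%N) (isoV : isometry V) (isoW : isometry W).
Let E := isochan (V *t W) (Phi C k).
(** The projector onto A tensored with the range of [W], which contains the range of [E]. *)
Let G : 'M[C]_(a * b) := 1%:M *t (W *m W^t*).
Let isoVW := isometry_tens isoV isoW.

Let adjE : E^t* = E.
Proof. exact/psd_hermitian/psd_conj/(proj1 (density_Phi k0)). Qed.

Let adjG : G^t* = G.
Proof. by rewrite /G adjmx_tens adjmx1 adjmxM trmxCK. Qed.

Let EE : E *m E = E.
Proof. by rewrite isochanM // PhiM. Qed.

Let GG : G *m G = G.
Proof. by rewrite tensmx_mul mul1mx mulmxA -(mulmxA W) isoW mulmx1. Qed.

Let GE : G *m E = E.
Proof.
by rewrite /E /isochan !mulmxA tensmx_mul mul1mx -(mulmxA W) isoW mulmx1.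
Qed.

Let EG : E *m G = E.
Proof. by rewrite -adjE -adjG -adjmxM GE. Qed.

(** A difference of nested projectors is a projector. *)
Let psdGE : psd (G - E).
Proof.
apply: psd_proj; first by rewrite adjmxD adjmxN adjG adjE.
by rewrite mulmxBl !mulmxBr GG GE EG EE subrr subr0.
Qed.

Let ptrE : ptrA E = k%:R^-1 *: (W *m W^t*).
Proof.
by rewrite ptrA_conj // ptrA_Phi /isochan -scalemx1 -scalemxAr mulmx1 -scalemxAl.
Qed.

(** The right-hand side is exactly [G], because the marginal of [E] is uniform on the range of
    [W]. *)
Lemma loewner_le_Phi : loewner_le E (k%:R *: (1%:M *t ptrA E)).
Proof.
by rewrite ptrE tensmxZr scalerA divff ?scale1r ?pnatr_eq0 -?lt0n.
Qed.

(* Off the range of [W W^*] the test succeeds with the constant probability that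
   makes its partial trace over A a multiple of the identity. *)
Lemma Phi_test : exists M : 'M[C]_(a * b),
  [/\ psd M, psd (1%:M - M), ptrA M = (k%:R^-1)%:M & \tr (M *m E) = 1].
Proof.
have a0 : (0 < a)%N by apply: leq_trans k0 (isometry_leq isoV).
pose G' : 'M[C]_(a * b) := 1%:M *t (1%:M - W *m W^t*).
have psdG' : psd G' by apply/psd_tens/psd_isometry_compl/isoW/psd1.
have eG' : G' = 1%:M - G by rewrite /G' tensmxBr tensmx11.
(* The partial trace of [G'] carries a factor [a], so [c * a = 1 / k] matches the weight of
   [W *m W^t*] in the marginal of [E]. *)
pose c : C := (k * a)%:R^-1.
have c0 : 0 <= c by rewrite invr_ge0 ler0n.
have c1 : c <= 1 by rewrite invf_le1 ?ltr0n ?ler1n muln_gt0 k0.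
exists (E + c *: G'); split.
- by apply: psdD (psdZ c0 psdG'); apply/psd_conj/(proj1 (density_Phi k0)).
- have -> : 1%:M - (E + c *: G') = (G - E) + (1 - c) *: G'.
    have {1}-> : 1%:M = G + G' by rewrite eG' addrC subrK.
    by rewrite scalerBl scale1r opprD addrACA.
  by apply: psdD psdGE _; apply: psdZ psdG'; rewrite subr_ge0.
- rewrite linearD linearZ /= ptrE ptrA_tens mxtrace1 scalerA.
  have -> : c * a%:R = k%:R^-1.
    by rewrite /c natrM invfM mulfVK // pnatr_eq0 -lt0n.
  by rewrite -scalerDr addrC subrK scalemx1.
- rewrite mulmxDl EE -scalemxAl eG' mulmxBl mul1mx GE subrr scaler0 addr0.
  exact: (proj2 (density_isochan isoVW (density_Phi k0))).
Qed.

End LocalImage.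

(** Conjugating by the adjoint of [V *t W] preserves the order and undoes the embedding on both
    sides. *)
Lemma loewner_le_isochan a b a' b' (V : 'M[C]_(a', a)) (W : 'M[C]_(b', b))
    (rho : 'M[C]_(a * b)) (c : C) :
  isometry V -> isometry W ->
  loewner_le (isochan (V *t W) rho) (c *: (1%:M *t ptrA (isochan (V *t W) rho))) ->
  loewner_le rho (c *: (1%:M *t ptrA rho)).
Proof.
move=> isoV isoW; rewrite ptrA_conj // => /(@psd_conj _ _ _ ((V *t W)^t*)).
rewrite -/(isochan _ _) linearB linearZ /= isochan_comp adjmx_tens tensmx_mul.
by rewrite isoV isoW tensmx11 isochan1 isochan_tens isochan_comp isoW isochan1
  {1}/isochan mulmx1 trmxCK isoV.
Qed.

End MaximallyEntangled.

(** * Entropies *)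

Section Entropy.
Variables (R : realType).

(** * Characterization of the logarithm and rational approximation *)

(** For each [k], [n ^ k] lies between consecutive powers [2 ^ p] and [2 ^ p.+1], so [f] and [log2]
    both send it into [[p, p + 1]]. Hence [k] times their distance at [n] is at most 1 for all [k],
    and the distance vanishes by the Archimedean property. *)
Lemma log2_unique (f : nat -> R) :
  f 2%N = 1 ->
  (forall m n, (0 < m)%N -> (0 < n)%N -> f (m * n)%N = f m + f n) ->
  (forall m n, (0 < m)%N -> (m <= n)%N -> f m <= f n) ->
  forall n, (0 < n)%N -> f n = log2 n%:R.
Proof.
move=> f2 fM f_le n n0.
have ln2 : 0 < ln 2 :> R by rewrite ln_gt0 // ltr1n.
have f1 : f 1%N = 0 by apply: (addrI (f 1%N)); rewrite addr0 -fM.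
have fX m k : (0 < m)%N -> f (m ^ k)%N = f m *+ k.
  move=> m0; elim: k => [|k IHk]; first by rewrite expn0 f1.
  by rewrite expnS fM ?expn_gt0 ?m0 // IHk mulrS.
have lnX m k : (0 < m)%N -> log2 (m ^ k)%:R = log2 m%:R *+ k :> R.
  by move=> m0; rewrite /log2 natrX lnXn ?ltr0n // mulrnAl.
have log2_le l m : (0 < l)%N -> (l <= m)%N -> log2 l%:R <= log2 m%:R :> R.
  move=> l0 le_lm; rewrite ler_pM2r ?invr_gt0 // ler_ln ?posrE ?ltr0n ?ler_nat //.
  exact: leq_trans le_lm.
have log22 : log2 2%:R = 1 :> R by rewrite /log2 divff // gt_eqF.
have bound k : `|f n - log2 n%:R| *+ k <= 1.
  have nk0 : (0 < n ^ k)%N by rewrite expn_gt0 n0.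
  have /andP[lo /ltnW up] := trunc_log_bounds (ltnSn 1) nk0.
  set p := trunc_log _ _ in lo up.
  have p0 q : (0 < 2 ^ q)%N by rewrite expn_gt0.
  have := f_le _ _ (p0 _) lo; have := f_le _ _ nk0 up.
  have := log2_le _ _ (p0 _) lo; have := log2_le _ _ nk0 up.
  rewrite !fX // !lnX // f2 log22 !mulrS -normrMn mulrnBl ler_norml => *.
  by apply/andP; split; lra.
apply/eqP; rewrite -subr_eq0 -normr_le0 leNgt; apply/negP => d0.
set d := `|_| in d0 bound; have d'0 : 0 <= d^-1 by rewrite invr_ge0 ltW.
have := archi_boundP d'0; set K := Num.bound _ => ltK.
have := bound K; rewrite leNgt => /negP; apply.
by rewrite -[_ *+ K]mulr_natl -ltr_pdivrMr // mul1r.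
Qed.

(** Density of the rationals, stated with positive naturals because [m] and [n] are to be dimensions
    of uniform states. *)
Lemma lt_ratio (x y : R) : 0 < x -> x < y -> exists m n : nat,
  [/\ (0 < m)%N, (0 < n)%N & x < m%:R / n%:R < y].
Proof.
move=> x0 /rat_in_itvoo[q]; rewrite in_itv /= => /andP[xq qy].
have q0 : 0 < q by rewrite -(ltr0q R) (lt_trans x0).
exists `|numq q|%N, `|denq q|%N; split.
- by rewrite absz_gt0 numq_eq0 gt_eqF.
- by rewrite absz_gt0 denq_neq0.
- rewrite -[q in ratr q]divq_num_den in xq qy.
  move: xq qy; rewrite fmorph_div /= !ratr_int => xq qy.
  have -> : `|numq q|%:R = (numq q)%:~R :> R.
    by rewrite -[in RHS](gtz0_abs (_ : 0 < numq q)) ?numq_gt0.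
  have -> : `|denq q|%:R = (denq q)%:~R :> R.
    by rewrite -[in RHS](gtz0_abs (denq_gt0 q)).
  by rewrite xq.
Qed.

Variable H : forall a b : nat, 'M[R[i]]_(a * b) -> R.
Hypotheses (H_ce : conditional_entropy H) (H_norm : normalized_entropy H).
Let u k : 'M[R[i]]_(k * 1) := uniform R[i] k *t (1%:M : 'M_1).

Let d1 : density (1%:M : 'M[R[i]]_1).
Proof. by split; [exact: psd1|rewrite mxtrace1]. Qed.

Let du k : (0 < k)%N -> density (u k).
Proof. by move=> k0; apply: density_tens (density_uniform _ k0) d1. Qed.

Lemma entropy_addu a b k (rho : 'M[R[i]]_(a * b)) : (0 < k)%N -> density rho ->
  H (reorder (rho *t u k)) = H rho + H (u k).
Proof. by move=> k0 drho; apply: (ce_additive H_ce) => //; apply: du. Qed.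

(** As a function of the dimension, the entropy of uniform states is additive on products,
    nondecreasing by majorization, and 1 at dimension 2 by normalization. *)
Lemma entropy_u k : (0 < k)%N -> H (u k) = log2 k%:R.
Proof.
have uM m n : (0 < m)%N -> (0 < n)%N -> H (u (m * n)) = H (u m) + H (u n).
  move=> m0 n0; rewrite -entropy_addu //; last exact: du.
  rewrite reorder_tens tensmx11; congr H.
  by rewrite /u [X in _ = X *t _]tensmx_scalar /uniform natrM invfM.
have u1 : H (u 1) = 0 by apply: (addrI (H (u 1))); rewrite addr0 -uM.
apply: (log2_unique (f := fun k => H (u k))) => [|//|m n m0].
  exact: H_norm.
rewrite leq_eqVlt => /orP[/eqP -> //|ltmn].
have n0 : (0 < n)%N by apply: leq_trans ltmn.
(* Reading [u n] as [u 1] tensored with [u n] makes it a target of [cond_majorizes_uniform], with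
   [rho := u 1]. *)
rewrite -[H (u n)]add0r -u1 -entropy_addu //; last exact: du.
have du1 := du (ltn0Sn 0).
apply: (ce_monotone H_ce); [exact: du|by apply/density_reorder/density_tens/du|].
apply: cond_majorizes_uniform => //; first by rewrite mul1n.
have -> : (1%:M : 'M[R[i]]_1) *t ptrA (u 1) = u 1.
  by rewrite ptrA_tens /uniform mxtrace_scalar invr1 mulr1n scale1r /u /uniform invr1.
apply: (loewner_le_scale (proj1 du1) (c := 1)).
  by rewrite ler_pdivlMr ?ltr0n // mul1r ler_nat ltnW.
by rewrite /loewner_le scale1r subrr; apply: psd0.
Qed.

Lemma entropy_lower a b m n (rho : 'M[R[i]]_(a * b)) :
  (0 < m)%N -> (0 < n)%N -> (m < a * n)%N -> density rho ->
  loewner_le rho ((n%:R / m%:R) *: (1%:M *t ptrA rho)) ->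
  log2 m%:R - log2 n%:R <= H rho.
Proof.
move=> m0 n0 ltm drho le_rho; rewrite lerBlDr -!entropy_u // -entropy_addu //.
apply: (ce_monotone H_ce); [exact: du|by apply/density_reorder/density_tens/du|].
exact: cond_majorizes_uniform.
Qed.

Lemma entropy_upper a b k (rho M : 'M[R[i]]_(a * b)) :
  (0 < k)%N -> density rho -> psd M -> psd (1%:M - M) ->
  ptrA M = (k%:R^-1)%:M -> \tr (M *m rho) = 1 -> H rho <= - log2 k%:R.
Proof.
move=> k0 drho pM pM' ptrM Mrho; rewrite -subr_le0 opprK -entropy_u //.
rewrite -entropy_addu //.
have <- : H (u 1) = 0 by rewrite entropy_u // /log2 ln1 mul0r.
apply: (ce_monotone H_ce); [by apply/density_reorder/density_tens/du|exact: du|].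
exact: cond_majorizes_pure Mrho.
Qed.

(** * The set of admissible factors in the min-entropy *)

Section HminSet.
Variables (a b : nat) (rho : 'M[R[i]]_(a * b)).
Hypothesis drho : density rho.
Let S := [set l : R | 0 <= l /\
  loewner_le rho ((l%:C)%C *: (1%:M *t ptrA rho))]%classic.

Let psd1rho : psd ((1%:M : 'M_a) *t ptrA rho).
Proof. by apply: psd_tens; [exact: psd1|exact: psd_ptrA (proj1 drho)]. Qed.

Lemma mem_Hmin_set_dim : S a%:R.
Proof.
split; first exact: ler0n.
by rewrite (rmorph_nat (real_complex R)); apply/loewner_le_ptrA/(proj1 drho).
Qed.

(** Take traces in the Loewner inequality. *)
Lemma Hmin_set_ge l : S l -> 1 <= l * a%:R.
Proof.
case=> _ /psd_trace; rewrite linearB linearZ /= mxtrace_tens mxtrace1.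
rewrite mxtrace_ptrA (proj2 drho) mulr1 subr_ge0.
by rewrite -(rmorph_nat (real_complex R)) -rmorphM -(rmorph1 (real_complex R)) lecR.
Qed.

Lemma Hmin_set_up l m : S l -> l <= m -> S m.
Proof.
case=> l0 le_rho lm; split; first exact: le_trans lm.
by apply: loewner_le_scale le_rho => //; rewrite lecR.
Qed.

Let dim_gt0 : 0 < a%:R :> R.
Proof.
have := Hmin_set_ge mem_Hmin_set_dim; rewrite ltr0n lt0n.
by case: a => //; rewrite mulr0 ler10.
Qed.

(** The trace bound keeps every admissible factor above [1 / a]. Positivity lets [ln] and [expR] be
    inverted at the infimum. *)
Lemma inf_Hmin_set_gt0 : 0 < inf S.
Proof.
apply: (@lt_le_trans _ _ (a%:R^-1)); first by rewrite invr_gt0 dim_gt0.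
apply: lb_le_inf; first by exists a%:R; apply: mem_Hmin_set_dim.
by move=> l /Hmin_set_ge; rewrite -ler_pdivrMr ?dim_gt0 // mul1r.
Qed.

Lemma Hmin_ge l : S l -> - log2 l <= Hmin rho.
Proof.
move=> Sl; rewrite lerN2 ler_pM2r ?invr_gt0 ?ln_gt0 ?ltr1n //.
have S0 := inf_Hmin_set_gt0.
have le_inf : inf S <= l by apply: ge_inf => //; exists 0 => x [].
by rewrite ler_ln ?posrE // (lt_le_trans S0).
Qed.

(** Otherwise 2 to the power [H rho] is below [1 / s], and some ratio [m / n] lies strictly between.
    Then [n / m] exceeds the infimum [s], so it is admissible, and [entropy_lower] contradicts the
    choice of [m / n]. *)
Lemma Hmin_le_entropy : Hmin rho <= H rho.
Proof.
have ln2 : 0 < ln 2 :> R by rewrite ln_gt0 // ltr1n.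
have s0 := inf_Hmin_set_gt0; rewrite /Hmin -/S.
set s := inf S in s0 *; rewrite leNgt; apply/negP => ltH.
have : expR (H rho * ln 2) < s^-1.
  rewrite -[s^-1]lnK ?posrE ?invr_gt0 // ltr_expR lnV ?posrE //.
  by rewrite -ltr_pdivlMr // mulNr.
case/(lt_ratio (expR_gt0 _)) => m [n [m0 n0 /andP[lo up]]].
have mn0 : 0 < m%:R / n%:R :> R by rewrite divr_gt0 ?ltr0n.
have : s < n%:R / m%:R by rewrite -invf_div -[s]invrK ltf_pV2 ?posrE ?invr_gt0.
case/(inf_lt (ex_intro _ _ mem_Hmin_set_dim)) => l Sl lt_l.
have Snm := Hmin_set_up Sl (ltW lt_l).
(* The strict bound comes from an admissible [l] below [n / m], since [l] is at least [1 / a]. *)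
have ltm : (m < a * n)%N.
  have : 1 < n%:R / m%:R * a%:R :> R.
    by rewrite (le_lt_trans (Hmin_set_ge Sl)) // ltr_pM2r // dim_gt0.
  by rewrite mulrAC ltr_pdivlMr ?ltr0n // mul1r -natrM ltr_nat mulnC.
have := entropy_lower m0 n0 ltm drho.
rewrite -!(rmorph_nat (real_complex R)) -fmorph_div => /(_ (proj2 Snm)).
apply/negP; rewrite -ltNge /log2 -mulrBl -ln_div ?posrE ?ltr0n //.
by rewrite ltr_pdivlMr // -ltr_expR lnK.
Qed.

End HminSet.

(** [rho] conditionally majorizes its embedded image, which is also an image of [Phi], so [Phi_test]
    supplies the operator for [entropy_upper]. *)
Lemma entropy_le_local_iso a b k (rho : 'M[R[i]]_(a * b)) : (0 < k)%N ->
  density rho -> local_iso_equiv rho (Phi R[i] k) -> H rho <= - log2 k%:R.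
Proof.
move=> k0 drho [a2 [b2 [V [W [V' [W' [isoV isoW isoV' isoW' eqPhi]]]]]]].
have dV := density_isochan (isometry_tens isoV isoW) drho.
apply: (@le_trans _ _ (H (isochan (V *t W) rho))).
  exact/(ce_monotone H_ce drho dV)/cond_majorizes_isochan.
have [M [pM pM' ptrM Mrho]] := Phi_test k0 isoV' isoW'.
by apply: (entropy_upper k0 dV pM pM' ptrM); rewrite eqPhi.
Qed.

(** The factor [k] is admissible for the common image, and this pulls back to [rho]. *)
Lemma Hmin_ge_local_iso a b k (rho : 'M[R[i]]_(a * b)) : (0 < k)%N ->
  density rho -> local_iso_equiv rho (Phi R[i] k) -> - log2 k%:R <= Hmin rho.
Proof.
move=> k0 drho [a2 [b2 [V [W [V' [W' [isoV isoW isoV' isoW' eqPhi]]]]]]].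
apply: Hmin_ge => //; split; first exact: ler0n.
rewrite (rmorph_nat (real_complex R)); apply: (loewner_le_isochan isoV isoW).
by rewrite eqPhi; apply: loewner_le_Phi.
Qed.

(** The bounds close a chain from [- log2 k] through [Hmin rho] and [H rho] back to [- log2 k]. *)
Lemma entropy_local_iso a b k (rho : 'M[R[i]]_(a * b)) : (0 < k)%N ->
  density rho -> local_iso_equiv rho (Phi R[i] k) ->
  H rho = - log2 k%:R /\ Hmin rho = - log2 k%:R.
Proof.
move=> k0 drho isorho; have leH := entropy_le_local_iso k0 drho isorho.
have geHmin := Hmin_ge_local_iso k0 drho isorho.
have le := Hmin_le_entropy drho.
by split; apply/le_anti; rewrite ?leH ?geHmin ?(le_trans geHmin) ?(le_trans le).
Qed.

End Entropy.

Theorem theorem1 (R : realType) (H : forall a b : nat, 'M[R[i]]_(a * b) -> R)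
    (H_ce : conditional_entropy H) (H_norm : normalized_entropy H) :
  [/\ (forall (a b : nat) (rho : 'M[R[i]]_(a * b)), density rho ->
         Hmin rho <= H a b rho),
      (forall (a b k : nat) (rho : 'M[R[i]]_(a * b)), (1 <= k)%N ->
         density rho -> local_iso_equiv rho (Phi R[i] k) ->
         H a b rho = Hmin rho)
    & (forall k : nat, (1 <= k)%N -> H k k (Phi R[i] k) = - log2 k%:R)].
Proof.
split=> [a b rho drho|a b k rho k0 drho isorho|k k0].
- exact: Hmin_le_entropy.
- by have [-> ->] := entropy_local_iso H_ce H_norm k0 drho isorho.
- have [] // := entropy_local_iso H_ce H_norm k0 (density_Phi _ k0).
  by exists k, k, 1%:M, 1%:M, 1%:M, 1%:M; split; try exact: isometry1.
Qed.
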